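(* Let $A_1A_2A_3A_4$ be a quadrilateral inscribed in a nondegenerate conic $\mathcal{C}$, and let the points $M_j,N_3,P_3,X_i,T_i$, the conic $\mathcal{C}_1$ and the points $J_1,\dots,J_8$ be as defined in the context (in general position as specified there). Then: \begin{itemize} \item The lines $J_iJ_{i+4}$, for $i=1,2,3,4$, intersect at the point $M_3$. \item The lines $J_1J_7$, $J_2J_6$ and $J_3J_5$ intersect at $M_1$, and the lines $J_1J_3$, $J_4J_8$ and $J_5J_7$ intersect at $M_2$. \item The lines $J_1J_4$ and $J_2J_5$ intersect at $A_1$, the lines $J_4J_7$ and $J_3J_6$ at $A_2$, the lines $J_6J_1$ and $J_5J_8$ at $A_3$, and the lines $J_3J_8$ and $J_2J_7$ at $A_4$. \item The intersection points $l(J_2J_4)\cap l(J_6J_8)$, $l(J_2J_8)\cap l(J_4J_6)$, $l(J_3J_6)\cap l(J_2J_7)$, $l(J_5J_8)\cap l(J_1J_4)$, $l(J_3J_8)\cap l(J_4J_7)$, $l(J_2J_5)\cap l(J_1J_6)$ and $l(J_iJ_{i+1})\cap l(J_{i+4}J_{i+5})$ for $i=1,2,3,4$ all lie on the line $M_1M_2$. \item The intersection points $l(J_4J_5)\cap l(J_7J_8)$ and $l(J_3J_4)\cap l(J_1J_8)$ lie on the line $M_1M_3$, and the intersection points $l(J_2J_3)\cap l(J_5J_6)$ and $l(J_1J_2)\cap l(J_6J_7)$ lie on the line $M_2M_3$. \item The point $P_3$ lies on the line $J_3J_7$ and the point $N_3$ lies on the line $J_1J_5$. \item The three lines $J_{2i}J_{2i+4}$,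 $J_{2i+1}J_{2i-2}$ and $J_{2i-1}J_{2i+2}$ (indices modulo $8$) are concurrent for $i=1,2,3,4$. \end{itemize}
   Context: The ambient plane is the complex projective plane (real configurations being included), and $A_1,A_2,A_3,A_4$ are four distinct points of the nondegenerate conic $\mathcal{C}$. For distinct points $P,Q$, $l(PQ)$ (or simply $PQ$) denotes the line through them. Let $t_i$ be the tangent line to $\mathcal{C}$ at $A_i$. Let $M_1=A_1A_2\cap A_3A_4$, $M_2=A_2A_3\cap A_4A_1$, $M_3=A_1A_3\cap A_2A_4$, $N_3=t_1\cap t_3$, $P_3=t_2\cap t_4$. Let $T_1=A_3A_4\cap t_1$, $T_2=A_4A_1\cap t_2$, $T_3=A_1A_2\cap t_3$, $T_4=A_2A_3\cap t_4$, and $X_1=A_2A_3\cap t_1$, $X_2=A_3A_4\cap t_2$, $X_3=A_4A_1\cap t_3$, $X_4=A_1A_2\cap t_4$. The eight points $X_1,\dots,X_4,T_1,\dots,T_4$ lie on one conic, denoted $\mathcal{C}_1$. For $i=1,2,3,4$, let $J_{2i-1}$ be the intersection point of the tangent lines to $\mathcal{C}_1$ at $X_{i-2}$ and $T_i$, and let $J_{2i}$ be the intersection point of the tangent lines to $\mathcal{C}_1$ at $X_{i-1}$ and $T_i$ (indices of $X$ modulo $4$, in $\{1,2,3,4\}$). Explicitly, $J_1,\dots,J_8$ are the intersection points of the tangents to $\mathcal{C}_1$ at the pairs $(X_3,T_1)$, $(X_4,T_1)$, $(X_4,T_2)$, $(X_1,T_2)$, $(X_1,T_3)$, $(X_2,T_3)$,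 $(X_2,T_4)$, $(X_3,T_4)$ respectively. Indices of $J$ are taken modulo $8$ in $\{1,\dots,8\}$. General position: the points $X_1,\dots,X_4,T_1,\dots,T_4$ are pairwise distinct, $\mathcal{C}_1$ is nondegenerate, and all points and lines named in the claim are well defined. *)

(* Defs.v *)
From HB Require Import structures.
From mathcomp Require Export all_boot all_order all_algebra.
From mathcomp Require Export reals.
From mathcomp Require Export complex.
Set Implicit Arguments.
Unset Strict Implicit.
Unset Printing Implicit Defensive.
Import GRing.Theory.
Local Open Scope ring_scope.

(* The projective plane over F is the lattice of row spaces of matrices with
   three columns: a point is a row space of rank 1, a line one of rank 2, the
   line PQ is (P + Q)%MS, the intersection of two lines is (l :&: m)%MS,
   incidence is (P <= l)%MS, and two matrices are the same point or line when
   (P == Q)%MS. *)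

Section Conics.
Variable F : fieldType.

(* A conic x S x^T = 0 is represented by its symmetric Gram matrix S. *)
Definition nondegenerate_conic (S : 'M[F]_3) : bool :=
  (S^T == S) && (S \in unitmx).

(* The rows of P are scalar multiples c_i of one homogeneous coordinate vector v
   of the point, and P S P^T has entries c_i c_j (v S v^T). *)
Definition on_conic m (S : 'M[F]_3) (P : 'M[F]_(m, 3)) : bool :=
  P *m S *m P^T == 0.

(* The tangent line to x S x^T = 0 at P is {x | x S P^T = 0}: up to the factor 2,
   S P^T is the gradient of the quadratic form at P. *)
Definition tangent m (S : 'M[F]_3) (P : 'M[F]_(m, 3)) : 'M[F]_3 :=
  kermx (S *m P^T).

End Conics.

Section Configuration.
Variables (F : fieldType) (C C1 : 'M[F]_3) (A : 'Z_4 -> 'rV[F]_3).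

(* Indices live in 'Z_4 and 'Z_8, so that A 4 is A 0 and J 8 is J 0. *)

Definition ptM1 : 'M[F]_3 := ((A 1 + A 2) :&: (A 3 + A 4))%MS.
Definition ptM2 : 'M[F]_3 := ((A 2 + A 3) :&: (A 4 + A 1))%MS.
Definition ptM3 : 'M[F]_3 := ((A 1 + A 3) :&: (A 2 + A 4))%MS.

Definition ptN3 : 'M[F]_3 := (tangent C (A 1) :&: tangent C (A 3))%MS.
Definition ptP3 : 'M[F]_3 := (tangent C (A 2) :&: tangent C (A 4))%MS.

Definition ptT (i : 'Z_4) : 'M[F]_3 :=
  ((A (i + 2)%R + A (i + 3)%R) :&: tangent C (A i))%MS.
Definition ptX (i : 'Z_4) : 'M[F]_3 :=
  ((A (i + 1)%R + A (i + 2)%R) :&: tangent C (A i))%MS.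

(* With i = uphalf j, the index j is 2i - 1 when odd and 2i when even; j = 0
   stands for 8 and gives i = 0, which stands for 4. *)
Definition ptJ (j : 'Z_8) : 'M[F]_3 :=
  let i : 'Z_4 := (uphalf j)%:R in
  let k : 'Z_4 := if odd j then i - 2 else i - 1 in
  (tangent C1 (ptX k) :&: tangent C1 (ptT i))%MS.

Definition lineJ (i j : 'Z_8) : 'M[F]_3 := (ptJ i + ptJ j)%MS.

Definition meetJ (i j k l : 'Z_8) : 'M[F]_3 := (lineJ i j :&: lineJ k l)%MS.

(* Distinctness of the J_j says that the lines J_iJ_j are well defined (every
   pair occurs in the theorem), and the rank conditions say that the pairs of
   lines whose intersection is named are pairs of distinct lines. The points
   M_j, N_3, P_3, X_i, T_i, J_j are well defined as soon as the A_i are distinct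
   points of a nondegenerate conic, and the X_i, T_i distinct points of C1. *)
Definition general_position : Prop :=
  [/\ [/\ forall i j, i != j -> ~~ (ptX i == ptX j)%MS,
          forall i j, i != j -> ~~ (ptT i == ptT j)%MS &
          forall i j, ~~ (ptX i == ptT j)%MS],
      forall i j, i != j -> ~~ (ptJ i == ptJ j)%MS,
      [/\ \rank (meetJ 2 4 6 8) = 1%N /\ \rank (meetJ 2 8 4 6) = 1%N,
          \rank (meetJ 3 6 2 7) = 1%N /\ \rank (meetJ 5 8 1 4) = 1%N &
          \rank (meetJ 3 8 4 7) = 1%N /\ \rank (meetJ 2 5 1 6) = 1%N],
      forall i, i \in [:: 1; 2; 3; 4] ->
          \rank (meetJ i (i + 1) (i + 4) (i + 5)) = 1%N &
      [/\ \rank (meetJ 4 5 7 8) = 1%N, \rank (meetJ 3 4 1 8) = 1%N,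
          \rank (meetJ 2 3 5 6) = 1%N & \rank (meetJ 1 2 6 7) = 1%N]].

End Configuration.

Definition concurrent (F : fieldType) (l1 l2 l3 : 'M[F]_3) : Prop :=
  exists P : 'rV[F]_3, P != 0 /\ [/\ (P <= l1)%MS, (P <= l2)%MS & (P <= l3)%MS].

(* Main.v *)
(* The vertices of an inscribed quadrilateral are, in a suitable frame, the points
   (+-1 : +-1 : 1), so that M_1, M_2, M_3 are the frame vertices and C has an
   equation a x^2 + b y^2 - (a + b) z^2 = 0. The sign changes preserve the whole
   picture: C1 is diagonal as well, proportional to (a^3, b^3, -(a + b) d) with
   d = a^2 + 3 a b + b^2, and the J_i form three orbits of sign changes with
   polynomial coordinates in a and b. Every incidence is then a polynomial
   identity in a and b; the nondegeneracy of C and C1 gives a, b, a + b, d <> 0,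
   and the distinctness of the X_i and T_i gives a + 2 b, 2 a + b <> 0. *)
From mathcomp Require Import ring.
Require Import Defs.
Set Implicit Arguments.
Unset Strict Implicit.
Unset Printing Implicit Defensive.
Import GRing.Theory.
Local Open Scope ring_scope.
Local Open Scope complex_scope.

(** * Cross products and incidence in a frame *)

Section Vectors.
Variable F : fieldType.
Implicit Types (x y z : F) (u v w : 'rV[F]_3).

Definition vec x y z : 'rV[F]_3 := \row_j nth 0 [:: x; y; z] j.

Lemma vecE x y z : ((vec x y z 0 0 = x) * (vec x y z 0 1 = y) * (vec x y z 0 2 = z))%type.
Proof. by rewrite !mxE. Qed.

Lemma ord3_ind (P : 'I_3 -> Prop) : P 0 -> P 1 -> P 2 -> forall i, P i.
Proof.
move=> P0 P1 P2 [[|[|[|//]]] lt_i]; [move: P0|move: P1|move: P2];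
  by congr P; apply: val_inj.
Qed.

Lemma vec_eta u : u = vec (u 0 0) (u 0 1) (u 0 2).
Proof. by apply/rowP; elim/ord3_ind; rewrite vecE. Qed.

Lemma sum_ord3 (V : nmodType) (E : 'I_3 -> V) : \sum_i E i = E 0 + E 1 + E 2.
Proof.
rewrite !big_ord_recl big_ord0 addr0 addrA.
by congr (E _ + E _ + E _); apply: val_inj.
Qed.

Lemma vec_eq0 x y z : (vec x y z == 0) = [&& x == 0, y == 0 & z == 0].
Proof.
apply/eqP/and3P => [/rowP e | [/eqP-> /eqP-> /eqP->]].
  by move: (e 0) (e 1) (e 2); rewrite !vecE !mxE => -> -> ->.
by apply/rowP; elim/ord3_ind; rewrite vecE mxE.
Qed.

Lemma scale_vec k x y z : k *: vec x y z = vec (k * x) (k * y) (k * z).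
Proof. by apply/rowP; elim/ord3_ind; rewrite mxE !vecE. Qed.

Definition dot u v : F := u 0 0 * v 0 0 + u 0 1 * v 0 1 + u 0 2 * v 0 2.

Lemma mulmx_tr_dot u v : u *m v^T = (dot u v)%:M.
Proof. by apply/matrixP => i j; rewrite !ord1 !mxE sum_ord3 !mxE. Qed.

Lemma mulmx_tr_eq0 u v : (u *m v^T == 0) = (dot u v == 0).
Proof.
by rewrite mulmx_tr_dot -scalemx1 scaler_eq0 oner_eq0 orbF.
Qed.

Definition cross u v : 'rV[F]_3 :=
  vec (u 0 1 * v 0 2 - u 0 2 * v 0 1) (u 0 2 * v 0 0 - u 0 0 * v 0 2)
      (u 0 0 * v 0 1 - u 0 1 * v 0 0).

Lemma dot_crossl u v : dot u (cross u v) = 0.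
Proof. by rewrite /dot /cross !vecE; ring. Qed.

Lemma dot_crossr u v : dot v (cross u v) = 0.
Proof. by rewrite /dot /cross !vecE; ring. Qed.

Lemma dotC u v : dot u v = dot v u.
Proof. by rewrite /dot; ring. Qed.

(** The triple product identity: a vector orthogonal to both [u] and [v] is parallel to [cross u v],
    which makes meets of lines computable. *)
Lemma cross_cross u v w : cross (cross u v) w = dot w u *: v - dot w v *: u.
Proof.
by apply/rowP; elim/ord3_ind; rewrite /cross !vecE !mxE /dot; ring.
Qed.

(** A division-free form of proportionality, valid at every index; an index with [u 0 i != 0] then
    exhibits [v] as a multiple of [u]. *)
Lemma cross_eq0_prop u v i : cross u v = 0 -> u 0 i *: v = v 0 i *: u.
Proof.
move/eqP; rewrite vec_eq0 !subr_eq0 => /and3P[/eqP e0 /eqP e1 /eqP e2].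
rewrite [in LHS](vec_eta v) [in RHS](vec_eta u) !scale_vec.
by elim/ord3_ind: i; congr vec; first
  [by rewrite mulrC | by rewrite e0 mulrC | by rewrite e1 mulrC | by rewrite e2 mulrC
  | by rewrite [RHS]mulrC -e0 | by rewrite [RHS]mulrC -e1 | by rewrite [RHS]mulrC -e2].
Qed.

Lemma cross_eq0_sub u v : u != 0 -> cross u v = 0 -> (v <= u)%MS.
Proof.
case/rV0Pn=> i ui0 uv0; apply/sub_rVP; exists (v 0 i / u 0 i).
by rewrite mulrC -scalerA -cross_eq0_prop // scalerA mulVf ?scale1r.
Qed.

Lemma sub_cross_eq0 u v : (v <= u)%MS -> cross u v = 0.
Proof.
case/sub_rVP=> k ->; apply/eqP; rewrite vec_eq0 !mxE.
by apply/and3P; split; apply/eqP; ring.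
Qed.

Lemma dot_vec x y z x' y' z' :
  dot (vec x y z) (vec x' y' z') = x * x' + y * y' + z * z'.
Proof. by rewrite /dot !vecE. Qed.

Lemma cross_vec x y z x' y' z' :
  cross (vec x y z) (vec x' y' z') =
  vec (y * z' - z * y') (z * x' - x * z') (x * y' - y * x').
Proof. by rewrite /cross !vecE. Qed.

Lemma vec_mul_diag x y z x' y' z' :
  vec x y z *m diag_mx (vec x' y' z') = vec (x * x') (y * y') (z * z').
Proof.
by apply/rowP => i; rewrite mul_mx_diag mxE; elim/ord3_ind: i; rewrite !vecE.
Qed.

Lemma mulmx_ord3 u (S : 'M[F]_3) j :
  (u *m S) 0 j = u 0 0 * S 0 j + u 0 1 * S 1 j + u 0 2 * S 2 j.
Proof. by rewrite mxE sum_ord3. Qed.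

Lemma vec_mul_rows (r : 'I_3 -> 'rV[F]_3) x y z :
  vec x y z *m (\matrix_i r i) = x *: r 0 + y *: r 1 + z *: r 2.
Proof. by rewrite mulmx_sum_row sum_ord3 !vecE !rowK. Qed.

Lemma det_diag_vec x y z : \det (diag_mx (vec x y z)) = x * y * z.
Proof. by rewrite det_diag !big_ord_recl big_ord0 /= !mxE /= mulr1 mulrA. Qed.

Hypothesis two_neq0 : 2%:R != 0 :> F.

(** Adding the four values of the quadratic form with the signs of a character of the group of sign
    changes cancels all but one mixed term, which appears 8 times. *)
Lemma diag_of_sign_changes (S : 'M[F]_3) x y z :
  S^T = S -> x != 0 -> y != 0 -> z != 0 ->
  (forall e f : bool, let p := vec ((-1) ^+ e * x) ((-1) ^+ f * y) z in
     dot (p *m S) p = 0) ->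
  S = diag_mx (vec (S 0 0) (S 1 1) (S 2 2)).
Proof.
move=> symS x0 y0 z0 q0.
have sym i j : S i j = S j i by rewrite -[in LHS]symS mxE.
have qE p q r : dot (vec p q r *m S) (vec p q r) =
    S 0 0 * p * p + S 1 1 * q * q + S 2 2 * r * r
    + 2%:R * (S 0 1 * p * q + S 0 2 * p * r + S 1 2 * q * r).
  rewrite /dot !mulmx_ord3 !vecE (sym 1 0) (sym 2 0) (sym 2 1); ring.
pose q (e f : bool) := let p := vec ((-1) ^+ e * x) ((-1) ^+ f * y) z in dot (p *m S) p.
have eight0 : 2 * 2 * 2 != 0 :> F by rewrite !mulf_neq0.
have S01 : S 0 1 = 0.
  apply: (mulfI (mulf_neq0 eight0 (mulf_neq0 x0 y0))); rewrite mulr0.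
  transitivity (q false false - q true false - q false true + q true true).
    by rewrite /q !qE !expr0 !expr1; ring.
  by rewrite /q !q0; ring.
have S02 : S 0 2 = 0.
  apply: (mulfI (mulf_neq0 eight0 (mulf_neq0 x0 z0))); rewrite mulr0.
  transitivity (q false false - q true false + q false true - q true true).
    by rewrite /q !qE !expr0 !expr1; ring.
  by rewrite /q !q0; ring.
have S12 : S 1 2 = 0.
  apply: (mulfI (mulf_neq0 eight0 (mulf_neq0 y0 z0))); rewrite mulr0.
  transitivity (q false false + q true false - q false true - q true true).
    by rewrite /q !qE !expr0 !expr1; ring.
  by rewrite /q !q0; ring.
apply/matrixP => i j; rewrite mxE; elim/ord3_ind: i; elim/ord3_ind: j;
  by rewrite /= ?vecE ?mulr1n ?mulr0n // ?(sym 1 0) ?(sym 2 0) ?(sym 2 1).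
Qed.

End Vectors.

(** * Points and lines as coordinate vectors in a frame *)

Section Frame.
Variables (F : fieldType) (g : 'M[F]_3).
Hypothesis gU : g \in unitmx.
Implicit Types (u v w : 'rV[F]_3).

Let g_free : row_free g. Proof. by rewrite row_free_unit. Qed.

(* Coordinates in the frame formed by the rows of g: u for points, and the
   coefficients w of an equation for lines. *)
Definition is_point m (P : 'M[F]_(m, 3)) u := u != 0 /\ (P :=: u *m g)%MS.

Definition is_line m (L : 'M[F]_(m, 3)) w :=
  w != 0 /\ (L :=: kermx (invmx g *m w^T))%MS.

(** The coordinates of a row [x] are [x *m invmx g], so the frame cancels and incidence is tested on
    coordinates alone. *)
Lemma is_line_sub m n (M : 'M_(m, 3)) (L : 'M_(n, 3)) w :
  is_line L w -> (M *m g <= L)%MS = (M *m w^T == 0).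
Proof. by case=> _ ->; rewrite sub_kermx -mulmxA mulKVmx. Qed.

Lemma point_on_line m n (P : 'M_(m, 3)) (L : 'M_(n, 3)) u w :
  is_point P u -> is_line L w -> (P <= L)%MS = (dot u w == 0).
Proof. by case=> _ -> Lw; rewrite (is_line_sub _ Lw) mulmx_tr_eq0. Qed.

Lemma rank_point m (P : 'M_(m, 3)) u : is_point P u -> \rank P = 1%N.
Proof. by case=> u0 ->; rewrite mxrankMfree // rank_rV u0. Qed.

Lemma rank_line m (L : 'M_(m, 3)) w : is_line L w -> \rank L = 2%N.
Proof.
case=> w0 ->; rewrite mxrank_ker -mxrank_tr trmx_mul trmxK mxrankMfree.
  by rewrite rank_rV w0.
by rewrite row_free_unit unitmx_tr unitmx_inv.
Qed.

Lemma is_point_scale m (P : 'M_(m, 3)) k u :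
  k != 0 -> is_point P (k *: u) -> is_point P u.
Proof.
move=> k0 [ku0 Pku]; split; first by apply: contraNneq ku0 => ->; rewrite scaler0.
by apply: (eqmx_trans Pku); rewrite -scalemxAl; apply: eqmx_scale.
Qed.

Lemma is_line_scale m (L : 'M_(m, 3)) k w :
  k != 0 -> is_line L (k *: w) -> is_line L w.
Proof.
move=> k0 [kw0 Lkw]; split; first by apply: contraNneq kw0 => ->; rewrite scaler0.
apply: (eqmx_trans Lkw); apply/eqmxP.
rewrite linearZ /= -scalemxAr !sub_kermx -scalemxAr mulmx_ker scaler0 eqxx andbT.
by rewrite -(inj_eq (scalerI k0)) scaler0 !scalemxAr mulmx_ker.
Qed.

Lemma cross_neq0_points m n (P : 'M_(m, 3)) (Q : 'M_(n, 3)) u v :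
  is_point P u -> is_point Q v -> ~~ (P == Q)%MS -> cross u v != 0.
Proof.
move=> Pu Qv; apply: contraNneq => uv0.
have sQP : (Q <= P)%MS.
  by case: Pu Qv => u0 -> [_ ->]; rewrite submxMfree // cross_eq0_sub.
by rewrite andbC sQP -(geq_leqif (mxrank_leqif_sup sQP)) (rank_point Pu) (rank_point Qv).
Qed.

Lemma is_line_join m n (P : 'M_(m, 3)) (Q : 'M_(n, 3)) u v :
  is_point P u -> is_point Q v -> cross u v != 0 ->
  is_line (P + Q)%MS (cross u v).
Proof.
move=> Pu Qv uv0; have L : is_line (kermx (invmx g *m (cross u v)^T)) (cross u v).
  by split.
split=> //; apply/eqmxP.
have sPQ : (P + Q <= kermx (invmx g *m (cross u v)^T))%MS.
  by rewrite addsmx_sub (point_on_line Pu L) (point_on_line Qv L)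
    dot_crossl dot_crossr eqxx.
(* Equality follows by dimension: a join of rank at most 1 would coincide with [P], making [v] a
   multiple of [u]. *)
rewrite sPQ -(geq_leqif (mxrank_leqif_sup sPQ)) (rank_line L) ltnNge.
apply: contra uv0 => r1; apply/eqP/sub_cross_eq0.
rewrite -(submxMfree _ _ g_free) -Pu.2 -Qv.2.
apply: submx_trans (addsmxSr P Q) _.
by rewrite -(geq_leqif (mxrank_leqif_sup (addsmxSl P Q))) (rank_point Pu).
Qed.

Lemma is_point_meet m n (L : 'M_(m, 3)) (M : 'M_(n, 3)) w z :
  is_line L w -> is_line M z -> cross w z != 0 ->
  is_point (L :&: M)%MS (cross w z).
Proof.
move=> Lw Mz wz0; split=> //; apply/eqmxP; rewrite sub_capmx.
have P : is_point (cross w z *m g) (cross w z) by split.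
rewrite (point_on_line P Lw) (point_on_line P Mz).
rewrite ![dot (cross _ _) _]dotC dot_crossl dot_crossr !eqxx !andbT.
(* Each row of the meet has coordinates orthogonal to [w] and [z], hence parallel to [cross w z] by
   the triple product identity. *)
apply/row_subP => i; set r := row i _.
have [rL rM] : (r <= L)%MS /\ (r <= M)%MS.
  by split; apply: submx_trans (row_sub _ _) _; [apply: capmxSl|apply: capmxSr].
move: rL rM; rewrite -[r](mulmxKV gU) (is_line_sub _ Lw) (is_line_sub _ Mz).
rewrite !mulmx_tr_eq0 submxMfree // => /eqP yw /eqP yz; apply: cross_eq0_sub => //.
set y := r *m _ in yw yz *.
by rewrite cross_cross yw yz !scale0r subr0.
Qed.

(** Proportional equations define the same line, whose meet with itself has rank 2. This is how the
    rank conditions of general position enter. *)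
Lemma cross_neq0_lines m n (L : 'M_(m, 3)) (M : 'M_(n, 3)) w z :
  is_line L w -> is_line M z -> \rank (L :&: M) = 1%N -> cross w z != 0.
Proof.
move=> Lw Mz r1; apply: contra_eqN r1 => /eqP wz0.
have /sub_rVP[k zkw] := cross_eq0_sub Lw.1 wz0.
have k0 : k != 0 by apply: contraNneq Mz.1 => k0; rewrite zkw k0 scale0r.
rewrite zkw in Mz; have [_ eM] := is_line_scale k0 Mz.
have LM : (L :=: M)%MS by apply: eqmx_trans Lw.2 (eqmx_sym eM).
by rewrite (cap_eqmx LM (eqmx_refl M)) (capmx_idPl (submx_refl M)) (rank_line Mz).
Qed.

(** In the frame the Gram matrix becomes [g *m S *m g^T], and the polar line of [u] is its product
    with [u]; the scalar [k] is discarded. *)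
Lemma is_line_tangent m (S : 'M_3) (P : 'M_(m, 3)) u w k :
  S^T = S -> is_point P u -> k != 0 -> w != 0 ->
  u *m (g *m S *m g^T) = k *: w -> is_line (tangent S P) w.
Proof.
move=> symS Pu k0 w0 uw; apply: (is_line_scale k0); split.
  by rewrite scaler_eq0 negb_or k0.
have -> : invmx g *m (k *: w)^T = S *m (u *m g)^T.
  by rewrite -uw !trmx_mul !trmxK symS !mulmxA mulVmx // mul1mx.
(* [P] may have several rows. One inclusion holds because [u *m g] lies in the row space of [P], the
   other because [P] is a left multiple of [u *m g]. *)
have kerS n (Q : 'M_(n, 3)) : (Q <= P)%MS -> (tangent S P <= kermx (S *m Q^T))%MS.
  case/submxP=> D ->.
  by rewrite sub_kermx trmx_mul !mulmxA -[_ *m S *m _]mulmxA mulmx_ker mul0mx.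
have [D PD] : exists D, P = D *m (u *m g).
  by apply/submxP; rewrite Pu.2.
apply/eqmxP; rewrite kerS ?Pu.2 //= sub_kermx [P]PD [(D *m _)^T]trmx_mul.
by rewrite !mulmxA -[_ *m S *m _]mulmxA mulmx_ker mul0mx.
Qed.

Lemma on_conic_point m (S : 'M_3) (P : 'M_(m, 3)) u :
  is_point P u -> on_conic S P -> dot (u *m (g *m S *m g^T)) u = 0.
Proof.
move=> Pu /eqP PSP; apply/eqP; rewrite -mulmx_tr_eq0.
have /submxP[E uE] : (u *m g <= P)%MS by rewrite Pu.2.
rewrite !mulmxA uE -!mulmxA -trmx_mul uE trmx_mul !mulmxA.
by rewrite -[E *m P *m S]mulmxA -[E *m _ *m _]mulmxA PSP mulmx0 mul0mx.
Qed.

(** Here and in [meet_at], cancelling a nonzero common factor [k] keeps the coordinates polynomials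
    of low degree. *)
Lemma join_at m n (P : 'M_(m, 3)) (Q : 'M_(n, 3)) u v w k :
  is_point P u -> is_point Q v -> k != 0 -> w != 0 ->
  cross u v = k *: w -> is_line (P + Q)%MS w.
Proof.
move=> Pu Qv k0 w0 uv; apply: (is_line_scale k0); rewrite -uv.
by apply: is_line_join; rewrite // uv scaler_eq0 negb_or k0.
Qed.

Lemma meet_at m n (L : 'M_(m, 3)) (M : 'M_(n, 3)) w z u k :
  is_line L w -> is_line M z -> k != 0 -> u != 0 ->
  cross w z = k *: u -> is_point (L :&: M)%MS u.
Proof.
move=> Lw Mz k0 u0 wz; apply: (is_point_scale k0); rewrite -wz.
by apply: is_point_meet; rewrite // wz scaler_eq0 negb_or k0.
Qed.

(** The rank hypothesis makes the meet a point, and what remains is a polynomial identity free of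
    nonvanishing conditions. *)
Lemma meet_sub_line m n p (L : 'M_(m, 3)) (M : 'M_(n, 3)) (N : 'M_(p, 3)) w z t :
  is_line L w -> is_line M z -> is_line N t ->
  \rank (L :&: M) = 1%N -> dot (cross w z) t = 0 -> (L :&: M <= N)%MS.
Proof.
move=> Lw Mz Nt r1 wzt; have wz0 := cross_neq0_lines Lw Mz r1.
by rewrite (point_on_line (is_point_meet Lw Mz wz0) Nt) wzt.
Qed.

Lemma point_eqmx m n (P : 'M_(m, 3)) (Q : 'M_(n, 3)) u :
  is_point P u -> is_point Q u -> (P :=: Q)%MS.
Proof. by case=> _ eP [_ eQ]; apply: eqmx_trans eP (eqmx_sym eQ). Qed.

Lemma concurrent_at (l1 l2 l3 : 'M[F]_3) (p : 'rV[F]_3) :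
  p != 0 -> (p *m g <= l1)%MS -> (p *m g <= l2)%MS -> (p *m g <= l3)%MS ->
  concurrent l1 l2 l3.
Proof.
move=> p0 P1 P2 P3; exists (p *m g); split=> //.
apply: contraNneq p0 => pg0; by rewrite -[p](mulmxK gU) pg0 mul0mx.
Qed.

End Frame.

(** The cases are numbered 1 to 4 as in the configuration; [4] is the ordinal 0. *)
Lemma Z4_ind (P : 'Z_4 -> Prop) : P 1 -> P 2 -> P 3 -> P 4 -> forall i, P i.
Proof.
move=> P1 P2 P3 P4 [[|[|[|[|//]]]] lt_i]; [move: P4|move: P1|move: P2|move: P3];
  by congr P; apply: val_inj.
Qed.

Lemma Z8_ind (P : 'Z_8 -> Prop) : P 1 -> P 2 -> P 3 -> P 4 -> P 5 -> P 6 ->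
  P 7 -> P 8 -> forall i, P i.
Proof.
move=> P1 P2 P3 P4 P5 P6 P7 P8 [[|[|[|[|[|[|[|[|//]]]]]]]] lt_i];
  [move: P8|move: P1|move: P2|move: P3|move: P4|move: P5|move: P6|move: P7];
  by congr P; apply: val_inj.
Qed.

(** Evaluates cyclic indices such as [i + 2] at a concrete [i] to literals, so that [nth] reduces in
    the coordinate lists. *)
Ltac compute_ord := repeat match goal with |- context [nat_of_ord ?x] =>
  let n := eval vm_compute in (nat_of_ord x) in change (nat_of_ord x) with n end.

(** * The configuration in the frame of the quadrilateral *)

Ltac vec_ring :=
  rewrite /= ?vec_mul_diag ?cross_vec ?scale_vec; congr vec; ring.

Section Configuration.
Variables (F : fieldType) (g C : 'M[F]_3) (A : 'Z_4 -> 'rV[F]_3) (a b : F).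
Hypothesis two_neq0 : 2 != 0 :> F.
Hypothesis gU : g \in unitmx.

(* Below, list entry 0 belongs to the index 4 (to 8 for vecJ), which is 0 in
   'Z_4 (in 'Z_8). *)
Definition vecA (i : 'Z_4) : 'rV[F]_3 :=
  nth 0 [:: vec 1 (-1) 1; vec 1 1 1; vec (-1) 1 1; vec (-1) (-1) 1] i.

Hypothesis symC : C^T = C.
Hypothesis A_distinct : forall i j, i != j -> ~~ (A i == A j)%MS.
Hypothesis A_point : forall i, is_point g (A i) (vecA i).
Hypothesis C_frame : g *m C *m g^T = diag_mx (vec a b (- (a + b))).
Hypotheses (a0 : a != 0) (b0 : b != 0) (s0 : a + b != 0).

Local Notation s := (a + b).
Local Notation u := (a + 2 * b).
Local Notation v := (2 * a + b).
Local Notation d := (a ^+ 2 + 3 * a * b + b ^+ 2).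

Definition vecT (i : 'Z_4) : 'rV[F]_3 :=
  nth 0 [:: vec (- b) (- v) b; vec u (- a) a; vec b v b; vec (- u) a a] i.
Definition vecX (i : 'Z_4) : 'rV[F]_3 :=
  nth 0 [:: vec u a a; vec (- b) v b; vec (- u) (- a) a; vec b (- v) b] i.

Lemma A_tangent i :
  is_line g (tangent C (A i)) (vecA i *m diag_mx (vec a b (- s))).
Proof.
apply: (is_line_tangent gU symC (A_point i) (oner_neq0 F)); last first.
  by rewrite scale1r C_frame.
by elim/Z4_ind: i; rewrite /vecA; compute_ord;
  rewrite vec_mul_diag vec_eq0 !mulf_eq0 ?oppr_eq0 oner_eq0 (negPf a0).
Qed.

Lemma A_line i j : i != j -> is_line g (A i + A j)%MS (cross (vecA i) (vecA j)).
Proof.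
move=> ij; apply: is_line_join => //.
exact: cross_neq0_points (A_point i) (A_point j) (A_distinct ij).
Qed.

Lemma T_point i : is_point g (ptT C A i) (vecT i).
Proof.
have two' : -2 != 0 :> F by rewrite oppr_eq0.
have L : is_line g (A (i + 2)%R + A (i + 3)%R)%MS (cross (vecA (i + 2)) (vecA (i + 3))).
  by apply: A_line; rewrite (inj_eq (addrI i)).
have t := A_tangent i; elim/Z4_ind: i L t => L t;
  (* Backtracking chooses the sign of the common factor: it is -2 for the points T_i and, in the
     next lemma, 2 for the points X_i. *)
  (apply: (meet_at gU L t two') + apply: (meet_at gU L t two_neq0));
  rewrite /vecA /vecT; compute_ord;
  rewrite /= ?vec_eq0 ?oppr_eq0 ?(negPf a0) ?(negPf b0) ?andbF //; vec_ring.
Qed.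

Lemma X_point i : is_point g (ptX C A i) (vecX i).
Proof.
have two' : -2 != 0 :> F by rewrite oppr_eq0.
have L : is_line g (A (i + 1)%R + A (i + 2)%R)%MS (cross (vecA (i + 1)) (vecA (i + 2))).
  by apply: A_line; rewrite (inj_eq (addrI i)).
have t := A_tangent i; elim/Z4_ind: i L t => L t;
  (apply: (meet_at gU L t two') + apply: (meet_at gU L t two_neq0));
  rewrite /vecA /vecX; compute_ord;
  rewrite /= ?vec_eq0 ?oppr_eq0 ?(negPf a0) ?(negPf b0) ?andbF //; vec_ring.
Qed.

(** * The conic C1, its tangents and the points J_i *)

Section SecondConic.
Variable C1 : 'M[F]_3.
Hypothesis C1_nondegenerate : nondegenerate_conic C1.
Hypothesis X_on_C1 : forall i, on_conic C1 (ptX C A i).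
Hypothesis T_on_C1 : forall i, on_conic C1 (ptT C A i).
Hypothesis XT_distinct : forall i j, ~~ (ptX C A i == ptT C A j)%MS.

Local Notation S1 := (g *m C1 *m g^T).

(** If [u = 0] then X_2 and T_1 coincide; if [v = 0] then X_1 and T_4 coincide. *)
Lemma XT_coord_neq0 : u != 0 /\ v != 0.
Proof.
split.
  apply: contraNneq (XT_distinct 2 1) => u0; apply/eqmxP.
  apply: (point_eqmx (X_point 2)); have := T_point 1.
  by rewrite /vecX /vecT; compute_ord; rewrite /= u0 oppr0.
apply: contraNneq (XT_distinct 1 4) => v0; apply/eqmxP.
apply: (point_eqmx (X_point 1)); have := T_point 4.
by rewrite /vecX /vecT; compute_ord; rewrite /= v0 oppr0.
Qed.

(* The points (+-u : +-a : a) among the X_i and T_i force C1 to be diagonal, and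
   one point (b : v : b) then determines the ratios of the diagonal entries. *)
Lemma C1_frame : exists k, [/\ k != 0, d != 0 &
  S1 = k *: diag_mx (vec (a ^+ 3) (b ^+ 3) (- (s * d)))].
Proof.
have [u0 v0] := XT_coord_neq0.
have symS1 : S1^T = S1.
  by case/andP: C1_nondegenerate => /eqP symC1 _; rewrite !trmx_mul trmxK symC1 mulmxA.
have qT i : dot (vecT i *m S1) (vecT i) = 0 := on_conic_point (T_point i) (T_on_C1 i).
have qX i : dot (vecX i *m S1) (vecX i) = 0 := on_conic_point (X_point i) (X_on_C1 i).
pose p := S1 0 0; pose q := S1 1 1; pose r := S1 2 2.
have S1_diag : S1 = diag_mx (vec p q r).
  apply: (diag_of_sign_changes two_neq0 symS1 u0 a0 a0).
  case; case; rewrite /= ?expr0 ?expr1 ?mul1r ?mulN1r.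
  - exact: (qX 2).
  - exact: (qT 3).
  - exact: (qT 1).
  - exact: (qX 4).
have e1 : - b * p * - b + v * q * v + b * r * b = 0.
  by rewrite -dot_vec -vec_mul_diag -S1_diag; apply: (qX 1).
have e4 : u * p * u + a * q * a + a * r * a = 0.
  by rewrite -dot_vec -vec_mul_diag -S1_diag; apply: (qX 4).
(* Eliminating [r] between [e4] and [e1] gives this relation times 4s, since u^2 - a^2 = 4bs and v^2
   - b^2 = 4as. *)
have pq : b ^+ 3 * p = a ^+ 3 * q.
  apply: (mulfI (mulf_neq0 (mulf_neq0 two_neq0 two_neq0) s0)).
  apply/eqP; rewrite -subr_eq0; apply/eqP.
  transitivity (b ^+ 2 * 0 - a ^+ 2 * 0 : F); last by ring.
  by rewrite -{1}e4 -e1; ring.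
have a3 : a ^+ 3 != 0 by rewrite expf_neq0.
have q_eq : q = p / a ^+ 3 * b ^+ 3.
  by apply: (mulfI a3); rewrite -pq; field.
(* With p and q proportional to a^3 and b^3, [e4] makes r proportional to -(a u^2 + b^3), which
   factors as -s d. This is where [d] comes from. *)
have r_eq : r = - (p / a ^+ 3 * (s * d)).
  apply: (mulfI (mulf_neq0 a0 a0)); apply/eqP; rewrite -subr_eq0; apply/eqP.
  by rewrite -e4 q_eq; field.
have S1E : S1 = p / a ^+ 3 *: diag_mx (vec (a ^+ 3) (b ^+ 3) (- (s * d))).
  by rewrite S1_diag -linearZ scale_vec divfK // -q_eq mulrN -r_eq.
have detS1 : \det S1 != 0.
  rewrite !det_mulmx det_tr !mulf_neq0 -?unitfE -?unitmxE //.
  by case/andP: C1_nondegenerate.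
exists (p / a ^+ 3); split=> //; apply: contraNneq detS1 => e0.
  by rewrite S1E e0 detZ expr0n mul0r.
by rewrite S1E detZ det_diag_vec e0 !mulr0 oppr0 !mulr0.
Qed.

Hypothesis d0 : d != 0.
Variable k : F.
Hypothesis k0 : k != 0.
Hypothesis S1E : S1 = k *: diag_mx (vec (a ^+ 3) (b ^+ 3) (- (s * d))).

(** The odd-indexed points are the four sign changes of one point; J_2 and J_6 lie on M_1M_3 (y =
    0), J_4 and J_8 on M_2M_3 (x = 0). *)
Definition vecJ (j : 'Z_8) : 'rV[F]_3 :=
  nth 0 [:: vec 0 (- (s * d)) (b ^+ 2 * v);
            vec (b * d) (- (a * d)) (a * b * s);
            vec (s * d) 0 (a ^+ 2 * u);
            vec (b * d) (a * d) (a * b * s);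
            vec 0 (s * d) (b ^+ 2 * v);
            vec (- (b * d)) (a * d) (a * b * s);
            vec (- (s * d)) 0 (a ^+ 2 * u);
            vec (- (b * d)) (- (a * d)) (a * b * s)] j.

Lemma C1_tangent m (P : 'M[F]_(m, 3)) w : is_point g P w ->
  is_line g (tangent C1 P) (w *m diag_mx (vec (a ^+ 3) (b ^+ 3) (- (s * d)))).
Proof.
move=> Pw; have /andP[/eqP symC1 _] := C1_nondegenerate.
apply: (is_line_tangent gU symC1 Pw k0); last by rewrite S1E -scalemxAr.
apply: contraNneq Pw.1 => w0; rewrite -[w]mulmx1.
have DU : diag_mx (vec (a ^+ 3) (b ^+ 3) (- (s * d))) \in unitmx.
  by rewrite unitmxE det_diag_vec unitfE !mulf_neq0 ?oppr_eq0 ?expf_neq0 ?mulf_neq0.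
by rewrite -(mulmxV DU) mulmxA w0 mul0mx.
Qed.

Ltac solve_J_point J_at h :=
  apply: (J_at _ _ _ _ h); rewrite /vecJ /vecX /vecT; compute_ord;
  [ by rewrite /= vec_eq0 ?oppr_eq0 ?mulf_eq0 ?(negPf a0) ?(negPf b0)
       ?(negPf s0) ?(negPf d0) ?andbF
  | rewrite ?expr0 ?expr1; vec_ring ].

Lemma J_point j : is_point g (ptJ C C1 A j) (vecJ j).
Proof.
(* The common factors of the cross products, up to sign: [k1] serves the odd indices, [k2] serves
   J_2 and J_6, [k3] serves J_4 and J_8. *)
have k1 (e : bool) : (-1) ^+ e * (2 * a ^+ 2 * b ^+ 2 * s) != 0.
  by rewrite !mulf_neq0 ?signr_eq0 ?expf_neq0.
have k2 (e : bool) : (-1) ^+ e * (2 * a ^+ 2 * b ^+ 3) != 0.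
  by rewrite !mulf_neq0 ?signr_eq0 ?expf_neq0.
have k3 (e : bool) : (-1) ^+ e * (2 * a ^+ 3 * b ^+ 2) != 0.
  by rewrite !mulf_neq0 ?signr_eq0 ?expf_neq0.
have J_at i i' w k' : k' != 0 -> w != 0 ->
    cross (vecX i *m diag_mx (vec (a ^+ 3) (b ^+ 3) (- (s * d))))
          (vecT i' *m diag_mx (vec (a ^+ 3) (b ^+ 3) (- (s * d)))) = k' *: w ->
    is_point g (tangent C1 (ptX C A i) :&: tangent C1 (ptT C A i'))%MS w.
  exact: meet_at (C1_tangent (X_point i)) (C1_tangent (T_point i')).
elim/Z8_ind: j; rewrite /ptJ; compute_ord => /=;
  first [ solve_J_point J_at (k1 false) | solve_J_point J_at (k1 true)
        | solve_J_point J_at (k2 false) | solve_J_point J_at (k2 true)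
        | solve_J_point J_at (k3 false) | solve_J_point J_at (k3 true) ].
Qed.

(** * Incidences of the lines J_iJ_j *)

Hypothesis gen_pos : general_position C C1 A.

Local Notation l := (lineJ C C1 A).
Local Notation m := (meetJ C C1 A).

Lemma J_line i j : i != j -> is_line g (l i j) (cross (vecJ i) (vecJ j)).
Proof.
move=> ij; case: gen_pos => _ J_distinct _ _ _.
apply: (is_line_join gU (J_point i) (J_point j)).
exact: cross_neq0_points (J_point i) (J_point j) (J_distinct _ _ ij).
Qed.

Lemma J_meet_sub i j i' j' n (N : 'M_(n, 3)) t :
  is_line g N t -> i != j -> i' != j' -> \rank (m i j i' j') = 1%N ->
  dot (cross (cross (vecJ i) (vecJ j)) (cross (vecJ i') (vecJ j'))) t = 0 ->
  (m i j i' j' <= N)%MS.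
Proof. by move=> Nt ij ij'; apply: (meet_sub_line gU (J_line ij) (J_line ij') Nt). Qed.

(** The nonzero factor [h] certifies that the two lines are distinct, so their meet is exactly the
    point and not a line through it. *)
Lemma J_meet_at i j i' j' n (P : 'M_(n, 3)) p h :
  is_point g P p -> i != j -> i' != j' -> h != 0 ->
  cross (cross (vecJ i) (vecJ j)) (cross (vecJ i') (vecJ j')) = h *: p ->
  (l i j :&: l i' j' :=: P)%MS.
Proof.
move=> Pp ij ij' h0 e; apply: (point_eqmx _ Pp).
exact: meet_at (J_line ij) (J_line ij') h0 Pp.1 e.
Qed.

Lemma J_line_through i j n (P : 'M_(n, 3)) p :
  is_point g P p -> i != j -> dot p (cross (vecJ i) (vecJ j)) = 0 -> (P <= l i j)%MS.
Proof. by move=> Pp ij e; rewrite (point_on_line gU Pp (J_line ij)) e. Qed.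

Ltac J_ring := rewrite /vecJ /vecA; compute_ord;
  rewrite /= ?cross_vec ?dot_vec ?scale_vec; first [ring | congr vec; ring].

Lemma M1_point : is_point g (ptM1 A) (vec 1 0 0).
Proof.
have h : - (2 * 2 * 2) != 0 :> F by rewrite oppr_eq0 !mulf_neq0.
by apply: (meet_at gU (A_line _) (A_line _) h);
  rewrite ?vec_eq0 ?oner_eq0 //; J_ring.
Qed.

Lemma M2_point : is_point g (ptM2 A) (vec 0 1 0).
Proof.
have h : - (2 * 2 * 2) != 0 :> F by rewrite oppr_eq0 !mulf_neq0.
by apply: (meet_at gU (A_line _) (A_line _) h);
  rewrite ?vec_eq0 ?oner_eq0 ?andbF //; J_ring.
Qed.

Lemma M3_point : is_point g (ptM3 A) (vec 0 0 1).
Proof.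
have h : 2 * 2 * 2 != 0 :> F by rewrite !mulf_neq0.
by apply: (meet_at gU (A_line _) (A_line _) h);
  rewrite ?vec_eq0 ?oner_eq0 ?andbF //; J_ring.
Qed.

Lemma N3_point : is_point g (ptN3 C A) (vec b (- a) 0).
Proof.
have h : - (2 * s) != 0 by rewrite oppr_eq0 mulf_neq0.
apply: (meet_at gU (A_tangent _) (A_tangent _) h); first by rewrite vec_eq0 (negPf b0).
by rewrite /vecA; compute_ord; vec_ring.
Qed.

Lemma P3_point : is_point g (ptP3 C A) (vec b a 0).
Proof.
have h : - (2 * s) != 0 by rewrite oppr_eq0 mulf_neq0.
apply: (meet_at gU (A_tangent _) (A_tangent _) h); first by rewrite vec_eq0 (negPf b0).
by rewrite /vecA; compute_ord; vec_ring.
Qed.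

Lemma M1M2_line : is_line g (ptM1 A + ptM2 A)%MS (vec 0 0 1).
Proof.
apply: (join_at gU M1_point M2_point (oner_neq0 F)); last by vec_ring.
by rewrite vec_eq0 oner_eq0 !andbF.
Qed.

Lemma M1M3_line : is_line g (ptM1 A + ptM3 A)%MS (vec 0 1 0).
Proof.
have N1 : -1 != 0 :> F by rewrite oppr_eq0 oner_eq0.
apply: (join_at gU M1_point M3_point N1); last by vec_ring.
by rewrite vec_eq0 oner_eq0 !andbF.
Qed.

Lemma M2M3_line : is_line g (ptM2 A + ptM3 A)%MS (vec 1 0 0).
Proof.
apply: (join_at gU M2_point M3_point (oner_neq0 F)); last by vec_ring.
by rewrite vec_eq0 oner_eq0.
Qed.

(** The first two lines meet in exactly M_3, with [h] the common factor of the double cross product;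
    the others then only have to pass through M_3. The claims on M_1 and M_2 follow the same
    scheme. *)
Lemma J_diagonals_meet : (l 1 5 :&: l 2 6 :&: l 3 7 :&: l 4 8 == ptM3 A)%MS.
Proof.
have [u0 _] := XT_coord_neq0.
have h : 2 * 2 * a ^+ 4 * b * s ^+ 2 * d ^+ 2 * u != 0.
  by rewrite !mulf_neq0 ?expf_neq0.
have e : (l 1 5 :&: l 2 6 :=: ptM3 A)%MS.
  by apply: (J_meet_at M3_point _ _ h) => //; J_ring.
apply/eqmxP; apply: eqmx_trans (cap_eqmx (cap_eqmx e (eqmx_refl _)) (eqmx_refl _)) _.
have M3_on_37 : (ptM3 A <= l 3 7)%MS by apply: (J_line_through M3_point) => //; J_ring.
have M3_on_48 : (ptM3 A <= l 4 8)%MS by apply: (J_line_through M3_point) => //; J_ring.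
exact: eqmx_trans (cap_eqmx (capmx_idPl M3_on_37) (eqmx_refl _)) (capmx_idPl M3_on_48).
Qed.

Lemma J_lines_meet_M1 : (l 1 7 :&: l 2 6 :&: l 3 5 == ptM1 A)%MS.
Proof.
have [u0 _] := XT_coord_neq0.
have h : - (2 * 2 * a ^+ 3 * b * d ^+ 3 * u * s) != 0.
  by rewrite oppr_eq0 !mulf_neq0 ?expf_neq0.
have e : (l 1 7 :&: l 2 6 :=: ptM1 A)%MS.
  by apply: (J_meet_at M1_point _ _ h) => //; J_ring.
apply/eqmxP; apply: eqmx_trans (cap_eqmx e (eqmx_refl _)) _.
by apply/capmx_idPl; apply: (J_line_through M1_point) => //; J_ring.
Qed.

Lemma J_lines_meet_M2 : (l 1 3 :&: l 4 8 :&: l 5 7 == ptM2 A)%MS.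
Proof.
have [_ v0] := XT_coord_neq0.
have h : 2 * 2 * a * b ^+ 3 * d ^+ 3 * s * v != 0.
  by rewrite !mulf_neq0 ?expf_neq0.
have e : (l 1 3 :&: l 4 8 :=: ptM2 A)%MS.
  by apply: (J_meet_at M2_point _ _ h) => //; J_ring.
apply/eqmxP; apply: eqmx_trans (cap_eqmx e (eqmx_refl _)) _.
by apply/capmx_idPl; apply: (J_line_through M2_point) => //; J_ring.
Qed.

Lemma J_lines_meet_A :
  [/\ (l 1 4 :&: l 2 5 == A 1)%MS, (l 4 7 :&: l 3 6 == A 2)%MS,
      (l 6 1 :&: l 5 8 == A 3)%MS & (l 3 8 :&: l 2 7 == A 4)%MS].
Proof.
(* By the sign symmetry the four meets carry the same common factor up to sign. *)
have h : 2 * a ^+ 2 * b ^+ 2 * s ^+ 2 * d ^+ 3 != 0.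
  by rewrite !mulf_neq0 ?expf_neq0.
have h' : - (2 * a ^+ 2 * b ^+ 2 * s ^+ 2 * d ^+ 3) != 0 by rewrite oppr_eq0.
split; apply/eqmxP;
  first [ by apply: (J_meet_at (A_point _) _ _ h) => //; J_ring
        | by apply: (J_meet_at (A_point _) _ _ h') => //; J_ring ].
Qed.

(** M_1M_2 is the line z = 0, so each claim says that the third coordinate of a double cross product
    vanishes; [gen_pos] ensures that the meets are points. *)
Lemma J_meets_on_M1M2 :
  let L := (ptM1 A + ptM2 A)%MS in
  [/\ (m 2 4 6 8 <= L)%MS, (m 2 8 4 6 <= L)%MS,
      (m 3 6 2 7 <= L)%MS & (m 5 8 1 4 <= L)%MS]
  /\ [/\ (m 3 8 4 7 <= L)%MS, (m 2 5 1 6 <= L)%MS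
       & forall i : 'Z_8, i \in [:: 1; 2; 3; 4] ->
           (m i (i + 1)%R (i + 4)%R (i + 5)%R <= L)%MS].
Proof.
case: gen_pos => _ _ [[r1 r2] [r3 r4] [r5 r6]] r _ L.
split; split; try by apply: (J_meet_sub M1M2_line) => //; J_ring.
move=> i i_in; apply: (J_meet_sub M1M2_line); last 2 first.
- exact: r.
- by move: i_in; rewrite !inE => /or4P[]/eqP->; J_ring.
all: by move: i_in; rewrite !inE => /or4P[]/eqP->.
Qed.

Lemma J_meets_on_M1M3_M2M3 :
  [/\ (m 4 5 7 8 <= ptM1 A + ptM3 A)%MS, (m 3 4 1 8 <= ptM1 A + ptM3 A)%MS,
      (m 2 3 5 6 <= ptM2 A + ptM3 A)%MS & (m 1 2 6 7 <= ptM2 A + ptM3 A)%MS].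
Proof.
case: gen_pos => _ _ _ _ [r1 r2 r3 r4].
split; by [ apply: (J_meet_sub M1M3_line) => //; J_ring
          | apply: (J_meet_sub M2M3_line) => //; J_ring ].
Qed.

Lemma P3_on_J37 : (ptP3 C A <= l 3 7)%MS.
Proof. by apply: (J_line_through P3_point) => //; J_ring. Qed.

Lemma N3_on_J15 : (ptN3 C A <= l 1 5)%MS.
Proof. by apply: (J_line_through N3_point) => //; J_ring. Qed.

(* Q_i is the point of concurrence in the last claim. *)
Definition vecQ (i : 'Z_8) : 'rV[F]_3 :=
  nth 0 [:: 0; vec (s * d) 0 (a * (d + b * s)); vec 0 (s * d) (b * (d + a * s));
            vec (- (s * d)) 0 (a * (d + b * s)); vec 0 (- (s * d)) (b * (d + a * s))] i.

(** For odd [i] the first line is M_1M_3, for even [i] it is M_2M_3, whence the zero coordinate of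
    Q_i. Q_3 and Q_4 are sign changes of Q_1 and Q_2. *)
Lemma J_lines_concurrent (i : 'Z_8) : i \in [:: 1; 2; 3; 4] ->
  concurrent (l (2 * i) (2 * i + 4)) (l (2 * i + 1) (2 * i - 2))
             (l (2 * i - 1) (2 * i + 2)).
Proof.
rewrite !inE => /or4P[]/eqP->.
1: pose Q := vecQ 1. 2: pose Q := vecQ 2. 3: pose Q := vecQ 3. 4: pose Q := vecQ 4.
all: have Q0 : Q != 0 by rewrite /Q /vecQ; compute_ord;
  rewrite /= vec_eq0 ?oppr_eq0 mulf_eq0 (negPf s0) (negPf d0) ?andbF.
all: have QQ : is_point g (Q *m g) Q by split.
all: by apply: (concurrent_at gU Q0); apply: (J_line_through QQ) => //;
  rewrite /Q /vecQ; J_ring.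
Qed.

End SecondConic.
End Configuration.

(** * Normalization of four points of a conic *)

Section FrameOfConicPoints.
Variable F : fieldType.
Hypothesis two_neq0 : 2 != 0 :> F.

Lemma rank_adds_distinct n (P Q : 'rV[F]_n) :
  P != 0 -> Q != 0 -> ~~ (P == Q)%MS -> \rank (P + Q)%MS = 2%N.
Proof.
move=> P0 Q0 PQ; have [rP rQ] : \rank P = 1%N /\ \rank Q = 1%N.
  by rewrite !rank_rV P0 Q0.
apply/eqP; rewrite eqn_leq; apply/andP; split.
  by rewrite (leq_trans (mxrank_adds_leqif _ _)) // rP rQ.
rewrite ltnNge; apply: contra PQ => r1.
have eP : (P == P + Q)%MS by rewrite -(geq_leqif (mxrank_leqif_eq (addsmxSl P Q))) rP.
have eQ : (Q == P + Q)%MS by rewrite -(geq_leqif (mxrank_leqif_eq (addsmxSr P Q))) rQ.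
apply/eqmxP; exact: eqmx_trans (eqmxP eP) (eqmx_sym (eqmxP eQ)).
Qed.

(* A conic containing a line has a totally isotropic subspace of dimension 2 in
   a nondegenerate space of dimension 3. *)
Lemma conic_chord_neq0 (S : 'M[F]_3) (P Q : 'rV[F]_3) :
  nondegenerate_conic S -> P != 0 -> Q != 0 -> ~~ (P == Q)%MS ->
  on_conic S P -> on_conic S Q -> P *m S *m Q^T != 0.
Proof.
case/andP=> /eqP symS SU P0 Q0 PQ /eqP PP /eqP QQ; apply/negP => /eqP PQ0.
have QP0 : Q *m S *m P^T = 0.
  transitivity ((P *m S *m Q^T)^T); last by rewrite PQ0 trmx0.
  by rewrite !trmx_mul trmxK symS mulmxA.
have B0 : col_mx P Q *m (S *m (col_mx P Q)^T) = 0.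
  rewrite mulmxA tr_col_mx mul_col_mx mul_col_row PP QQ PQ0 QP0.
  exact: block_mx0.
(* Both factors have rank 2, while a zero product bounds the sum of their ranks by 3. *)
have := mulmx0_rank_max B0.
rewrite -(mxrank_tr (S *m _)) trmx_mul trmxK symS mxrankMfree ?row_free_unit //.
by rewrite -(addsmxE P Q) rank_adds_distinct.
Qed.

(** If P = xQ + yR, the quadratic form at P is 2xy times the nonzero value of the bilinear form at Q
    and R. So x or y vanishes, and P is R or Q. *)
Lemma conic_not_collinear (S : 'M[F]_3) (P Q R : 'rV[F]_3) :
  nondegenerate_conic S -> on_conic S P -> on_conic S Q -> on_conic S R ->
  P != 0 -> Q != 0 -> R != 0 ->
  ~~ (P == Q)%MS -> ~~ (P == R)%MS -> ~~ (Q == R)%MS -> ~~ (P <= Q + R)%MS.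
Proof.
move=> ndS PS QS RS P0 Q0 R0 PQ PR QR.
have prop (U V : 'rV[F]_3) c : U != 0 -> V != 0 -> U = c *: V -> (U == V)%MS.
  move=> U0 V0 UV; have sUV : (U <= V)%MS by rewrite UV scalemx_sub.
  by rewrite -(geq_leqif (mxrank_leqif_eq sUV)) !rank_rV U0 V0.
apply/negP => /sub_addsmxP[[x y]] /=.
rewrite [x]mx11_scalar [y]mx11_scalar !mul_scalar_mx.
move: (x 0 0) (y 0 0) => {}x {}y Pxy.
have /eqP := PS; have QR0 := conic_chord_neq0 ndS Q0 R0 QR QS RS.
have RQ : R *m S *m Q^T = Q *m S *m R^T.
  case/andP: ndS => /eqP symS _.
  transitivity ((Q *m S *m R^T)^T); first by rewrite !trmx_mul trmxK symS mulmxA.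
  by rewrite [Q *m S *m R^T]mx11_scalar tr_scalar_mx.
rewrite Pxy linearD /= !linearZ /= !mulmxDl !mulmxDr -!scalemxAl -!scalemxAr.
rewrite (eqP QS) (eqP RS) RQ !scaler0 addr0 add0r !scalerA -scalerDl => /eqP.
rewrite scaler_eq0 (negPf QR0) orbF [y * x]mulrC -mulr2n -mulr_natl
  !mulf_eq0 (negPf two_neq0) /=.
case/orP=> /eqP e0; [move: PR|move: PQ]; apply/negP; rewrite negbK.
  by apply: (prop _ _ y) => //; rewrite Pxy e0 scale0r add0r.
by apply: (prop _ _ x) => //; rewrite Pxy e0 scale0r addr0.
Qed.

(** No three of the vertices are collinear, so they can be sent to any four points in general
    position. *)
Lemma frame_exists (S : 'M[F]_3) (A : 'Z_4 -> 'rV[F]_3) :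
  nondegenerate_conic S -> (forall i, A i != 0) -> (forall i, on_conic S (A i)) ->
  (forall i j, i != j -> ~~ (A i == A j)%MS) ->
  exists2 g : 'M[F]_3, g \in unitmx & forall i, is_point g (A i) (vecA F i).
Proof.
move=> ndS A0 AS A_distinct.
have ncol i j k : i != j -> i != k -> j != k -> ~~ (A i <= A j + A k)%MS.
  by move=> *; apply: (conic_not_collinear ndS); rewrite ?AS ?A0 ?A_distinct.
have full : row_full (A 1 + (A 2 + A 3))%MS.
  have A23 : ~~ (A 2 == A 3)%MS by apply: A_distinct.
  rewrite -col_leq_rank ltnNge -[X in (_ <= X)%N](rank_adds_distinct (A0 2) (A0 3) A23).
  rewrite (geq_leqif (mxrank_leqif_sup (addsmxSr _ _))) addsmx_sub submx_refl andbT.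
  exact: ncol.
have /sub_addsmxP[[x yz]] /= := submx_full (A 4) full.
have /sub_addsmxP[[y z] /= ->] : (yz *m (A 2 + A 3)%MS <= A 2 + A 3)%MS by apply: submxMl.
rewrite [x]mx11_scalar [y]mx11_scalar [z]mx11_scalar !mul_scalar_mx.
move: (x 0 0) (y 0 0) (z 0 0) => {yz} {}x {}y {}z A4.
(* A vanishing coefficient would put A_4 on the line through two other vertices. *)
have x0 : x != 0.
  apply: contraNneq (ncol 4 2 3 isT isT isT) => x0.
  by rewrite A4 x0 scale0r add0r addmx_sub_adds ?scalemx_sub.
have y0 : y != 0.
  apply: contraNneq (ncol 4 1 3 isT isT isT) => y0.
  by rewrite A4 y0 scale0r add0r addmx_sub_adds ?scalemx_sub.
have z0 : z != 0.
  apply: contraNneq (ncol 4 1 2 isT isT isT) => z0.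
  by rewrite A4 z0 scale0r addr0 addmx_sub_adds ?scalemx_sub.
(* These rows send the four sign vectors to 2x A_1, -2y A_2, 2z A_3 and 2 A_4. This is consistent
   because the sign vectors satisfy v_1 - v_2 + v_3 = v_4. *)
pose r (i : 'I_3) : 'rV_3 := nth 0 [:: x *: A 1 + y *: A 2;
  - (y *: A 2) - z *: A 3; x *: A 1 + z *: A 3] i.
pose g := \matrix_i r i.
have gE p q t : vec p q t *m g =
    ((p + t) * x) *: A 1 + ((p - q) * y) *: A 2 + ((t - q) * z) *: A 3.
  by rewrite vec_mul_rows /r; compute_ord; apply/rowP => i /=; rewrite !mxE; ring.
have vecA_g i : exists2 c, c != 0 & vecA F i *m g = c *: A i.
  elim/Z4_ind: i; rewrite /vecA; compute_ord; rewrite /= gE.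
  - exists (2 * x); first by rewrite mulf_neq0.
    by apply/rowP => i; rewrite !mxE; ring.
  - exists (- (2 * y)); first by rewrite oppr_eq0 mulf_neq0.
    by apply/rowP => i; rewrite !mxE; ring.
  - exists (2 * z); first by rewrite mulf_neq0.
    by apply/rowP => i; rewrite !mxE; ring.
  - exists 2 => //; rewrite A4.
    by apply/rowP => i; rewrite !mxE; ring.
have A_g i : (A i :=: vecA F i *m g)%MS.
  by have [c c0 ->] := vecA_g i; apply/eqmx_sym/eqmx_scale.
exists g.
  (* The row space of [g] contains A_1, A_2 and A_3, which span the whole space. *)
  rewrite -row_full_unit -sub1mx; apply: submx_trans (submx_full _ full) _.
  by rewrite !addsmx_sub !A_g !submxMl.
move=> i; split=> //; have [c c0 e] := vecA_g i.
apply: contraNneq (A0 i) => v0; move: e; rewrite v0 mul0mx => /esym/eqP.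
by rewrite scaler_eq0 (negPf c0).
Qed.

End FrameOfConicPoints.

(** The vertices are all the sign changes of (1 : 1 : 1), so the form is diagonal; vanishing at (1 :
    1 : 1) fixes its trace to 0, and the determinant gives the nonvanishing. *)
Lemma conic_frame (F : fieldType) (S g : 'M[F]_3) (A : 'Z_4 -> 'rV[F]_3) :
  2 != 0 :> F -> nondegenerate_conic S -> (forall i, on_conic S (A i)) ->
  g \in unitmx -> (forall i, is_point g (A i) (vecA F i)) ->
  exists a b, [/\ a != 0, b != 0, a + b != 0 &
    g *m S *m g^T = diag_mx (vec a b (- (a + b)))].
Proof.
move=> two_neq0 /andP[/eqP symS SU] AS gU A_point.
have symS' : (g *m S *m g^T)^T = g *m S *m g^T by rewrite !trmx_mul trmxK symS mulmxA.
have qA i : dot (vecA F i *m (g *m S *m g^T)) (vecA F i) = 0 :=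
  on_conic_point (A_point i) (AS i).
have n1 := oner_neq0 F.
have S_diag := diag_of_sign_changes two_neq0 symS' n1 n1 n1.
move: S_diag; set a := (_ *m _) 0 0; set b := (_ *m _) 1 1; set c := (_ *m _) 2 2.
move=> S_diag.
have {}S_diag : g *m S *m g^T = diag_mx (vec a b c).
  apply: S_diag; case; case; rewrite /= ?expr0 ?expr1 ?mul1r ?mulN1r.
  - exact: (qA 3).
  - exact: (qA 2).
  - exact: (qA 4).
  - exact: (qA 1).
have cE : c = - (a + b).
  apply/eqP; rewrite -addr_eq0 addrC; apply/eqP.
  transitivity (dot (vec 1 1 1 *m diag_mx (vec a b c)) (vec 1 1 1)).
    by rewrite vec_mul_diag dot_vec; ring.
  rewrite -S_diag; exact: (qA 1).
have : \det (g *m S *m g^T) != 0.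
  by rewrite !det_mulmx det_tr !mulf_neq0 // -unitfE -unitmxE.
rewrite S_diag det_diag_vec cE !mulf_eq0 oppr_eq0 !negb_or => /andP[/andP[a0 b0] s0].
exists a, b; split=> //; rewrite -cE; exact: S_diag.
Qed.

Theorem theorem4p1 (R : realType) (C C1 : 'M[R[i]]_3) (A : 'Z_4 -> 'rV[R[i]]_3)
  (C_nondegenerate : nondegenerate_conic C)
  (A_neq0 : forall i, A i != 0)
  (A_on_C : forall i, on_conic C (A i))
  (A_distinct : forall i j, i != j -> ~~ (A i == A j)%MS)
  (C1_nondegenerate : nondegenerate_conic C1)
  (X_on_C1 : forall i, on_conic C1 (ptX C A i))
  (T_on_C1 : forall i, on_conic C1 (ptT C A i))
  (gen_pos : general_position C C1 A) :
  let M1 := ptM1 A in let M2 := ptM2 A in let M3 := ptM3 A in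
  let N3 := ptN3 C A in let P3 := ptP3 C A in
  let l := lineJ C C1 A in let m := meetJ C C1 A in
  (l 1 5 :&: l 2 6 :&: l 3 7 :&: l 4 8 == M3)%MS
  /\ ((l 1 7 :&: l 2 6 :&: l 3 5 == M1)%MS
      /\ (l 1 3 :&: l 4 8 :&: l 5 7 == M2)%MS)
  /\ [/\ (l 1 4 :&: l 2 5 == A 1)%MS, (l 4 7 :&: l 3 6 == A 2)%MS,
         (l 6 1 :&: l 5 8 == A 3)%MS & (l 3 8 :&: l 2 7 == A 4)%MS]
  /\ ([/\ (m 2 4 6 8 <= M1 + M2)%MS, (m 2 8 4 6 <= M1 + M2)%MS,
          (m 3 6 2 7 <= M1 + M2)%MS & (m 5 8 1 4 <= M1 + M2)%MS]
      /\ [/\ (m 3 8 4 7 <= M1 + M2)%MS, (m 2 5 1 6 <= M1 + M2)%MS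
           & forall i : 'Z_8, i \in [:: 1; 2; 3; 4] ->
               (m i (i + 1)%R (i + 4)%R (i + 5)%R <= M1 + M2)%MS])
  /\ [/\ (m 4 5 7 8 <= M1 + M3)%MS, (m 3 4 1 8 <= M1 + M3)%MS,
         (m 2 3 5 6 <= M2 + M3)%MS & (m 1 2 6 7 <= M2 + M3)%MS]
  /\ ((P3 <= l 3 7)%MS /\ (N3 <= l 1 5)%MS)
  /\ (forall i : 'Z_8, i \in [:: 1; 2; 3; 4] ->
        concurrent (l (2 * i) (2 * i + 4))
                   (l (2 * i + 1) (2 * i - 2))
                   (l (2 * i - 1) (2 * i + 2))).
Proof.
(* The preceding lemmas hold over every field in which 2 is invertible; characteristic zero supplies
   this for [R[i]]. *)
have two_neq0 : 2 != 0 :> R[i] by rewrite Num.Theory.pnatr_eq0.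
have [g gU A_point] := frame_exists two_neq0 C_nondegenerate A_neq0 A_on_C A_distinct.
have [a [b [a0 b0 s0 C_frame]]] := conic_frame two_neq0 C_nondegenerate A_on_C gU A_point.
have symC : C^T = C by case/andP: C_nondegenerate => /eqP.
have XT : forall i j, ~~ (ptX C A i == ptT C A j)%MS by case: gen_pos => -[].
have [k [k0 d0 S1E]] := C1_frame two_neq0 gU symC A_distinct A_point C_frame a0 b0 s0
  C1_nondegenerate X_on_C1 T_on_C1 XT.
split; first exact: J_diagonals_meet S1E gen_pos.
split; first by split; [exact: J_lines_meet_M1 S1E gen_pos
                     | exact: J_lines_meet_M2 S1E gen_pos].
split; first exact: J_lines_meet_A S1E gen_pos.
split; first exact: J_meets_on_M1M2 S1E gen_pos.
split; first exact: J_meets_on_M1M3_M2M3 S1E gen_pos.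
split; first by split; [exact: P3_on_J37 S1E gen_pos | exact: N3_on_J15 S1E gen_pos].
by move=> i i_in; apply: J_lines_concurrent S1E gen_pos _ i_in.
Qed.
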